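(* $$\mathrm{IC}^{\mathrm{pub}}_{\mu_0^m}(\mathrm{ASCENSION}(m),\delta)\ \ge\ m\times \mathrm{IC}^{\mathrm{mix}}_{\mu_0}(\mathrm{MOUNTAIN},\delta).$$
   Context: $\mathrm I(\cdot:\cdot\,|\,\cdot)$ is conditional (Shannon) mutual information; $[n]=\{1,\ldots,n\}$. Worst-case error at most $\delta$ means that on every input the output is wrong with probability at most $\delta$ over the coins. In both problems messages have length at most a parameter $\mathrm{size}$ (in bits), a function of $m$ and $n$, and the information costs implicitly depend on $\mathrm{size}$. Problem $\mathrm{MOUNTAIN}$: Alice has $X\in\{0,1\}^n$; Bob has $k\in[n]$, a bit $c$, and the prefix $X[1,k-1]$ of $X$. The goal is to compute $f(X,k,c)=X[k]\oplus c$. In a one-pass protocol, Alice sends a message $M_A$ to Bob, Bob sends a message $M_B$ to Alice, then Alice outputs $f(X,k,c)$. In a ''mixed'' public and private coin randomized protocol, Alice and Bob share public coins $R$, and only Bob has access to extra, independent private coins $R_B$. For a distribution $\nu$ on $(X,k,c)$, $\mathrm{IC}_\nu(P)=\mathrm I(k,c:M_B\,|\,X,R)$, with inputs drawn from $\nu$ and $R$ denoting only the public coins of $P$. $\mathrm{IC}^{\mathrm{mix}}_\nu(\mathrm{MOUNTAIN},\delta)$ is the minimum of $\mathrm{IC}_\nu(P)$ over mixed randomized protocols $P$ for $\mathrm{MOUNTAIN}$ with worst-case error at most $\delta$. Problem $\mathrm{ASCENSION}(m)$: there are $2m$ players $A_1,\ldots,A_m$ and $B_1,\ldots,B_m$.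 Player $A_i$ has $X_i\in\{0,1\}^n$; player $B_i$ has $k_i\in[n]$, a bit $c_i$, and the prefix $X_i[1,k_i-1]$ of $X_i$. With $\mathbf X=(X_1,\ldots,X_m)$, $\mathbf k=(k_1,\ldots,k_m)$, $\mathbf c=(c_1,\ldots,c_m)$, the goal is to compute $f_m(\mathbf X,\mathbf k,\mathbf c)=\bigvee_{i=1}^m(X_i[k_i]\oplus c_i)$. In a one-pass protocol (a format motivated by the streaming model) the communication is in the following order. Round 1: for $i$ from $1$ to $m-1$, $A_i$ sends message $M_{A_i}$ to $B_i$, then $B_i$ sends message $M_{B_i}$ to $A_{i+1}$; then $A_m$ sends message $M_{A_m}$ to $B_m$. Round 2: $B_m$ sends message $M_{B_m}$ to $A_m$; then for $i$ from $m$ down to $2$, $A_i$ sends a message $M'_{A_i}$ to $A_{i-1}$; then $A_1$ computes the output. In a public-coin randomized protocol the only randomness is a string $R$ of public coins shared by all players. For a distribution $\nu$ on $(\mathbf X,\mathbf k,\mathbf c)$, $\mathrm{IC}_\nu(P)=\mathrm I(\mathbf k,\mathbf c:M_{B_m}\,|\,\mathbf X,R)$, with inputs drawn from $\nu$. $\mathrm{IC}^{\mathrm{pub}}_\nu(\mathrm{ASCENSION}(m),\delta)$ is the minimum of $\mathrm{IC}_\nu(P)$ over one-pass public-coin randomized protocols $P$ for the problem with worst-case error at most $\delta$. $\mu_0$ is the distribution of $(X,k,c)$ obtained from uniformly random $X\in\{0,1\}^n$, $k\in[n]$, $c\in\{0,1\}$ by conditioning on $X[k]=c$. Under $\mu_0^m$,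 a distribution over $(\{0,1\}^n\times[n]\times\{0,1\})^m$, the triples $(X_i,k_i,c_i)$, $i=1,\ldots,m$, are independent, each distributed according to $\mu_0$.
   Formalization: In ASCENSION(m) each message, and the output, depends only on the player's own input, the message just received and the public coins (streaming format); if A_i could in round 2 also use the message received in round 1, the inequality would fail, e.g. for n=6, size 4, δ=0 and large m. *)

(* Defs.v *)
From HB Require Import structures.
From mathcomp Require Import all_boot all_order all_algebra.
From mathcomp Require Import all_classical all_reals all_analysis.

Set Implicit Arguments.
Unset Strict Implicit.
Unset Printing Implicit Defensive.

Import Order.TTheory GRing.Theory Num.Theory.
Local Open Scope ring_scope.

(* Distributions on a finite type are given by their mass functions. *)

Definition is_dist (R : realType) (W : finType) (d : W -> R) : Prop :=
  (forall w, 0 <= d w) /\ \sum_w d w = 1.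

Definition pr (R : realType) (W : finType) (d : W -> R) (E : pred W) : R :=
  \sum_(w | E w) d w.

Definition unif (R : realType) (W : finType) : W -> R := fun _ => #|W|%:R^-1.

Definition cond (R : realType) (W : finType) (d : W -> R) (E : pred W) : W -> R :=
  fun w => if E w then d w / pr d E else 0.

Definition iid (R : realType) (W : finType) (d : W -> R) (m : nat) :
    {ffun 'I_m -> W} -> R :=
  fun f => \prod_i d (f i).

Definition log2 (R : realType) (x : R) : R := ln x / ln 2.

(* H(A | C); events of probability 0 contribute 0, as they have weight 0. *)
Definition cond_entropy (R : realType) (W TA TC : finType) (d : W -> R)
    (A : W -> TA) (C : W -> TC) : R :=
  - \sum_c \sum_a
      pr d (fun w => (A w == a) && (C w == c)) *
      log2 (pr d (fun w => (A w == a) && (C w == c)) / pr d (fun w => C w == c)).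

(* I(A : B | C) = H(A | C) - H(A | B, C) *)
Definition cond_mutual_info (R : realType) (W TA TB TC : finType) (d : W -> R)
    (A : W -> TA) (B : W -> TB) (C : W -> TC) : R :=
  cond_entropy d A C - cond_entropy d A (fun w => (B w, C w)).

(* Messages: bit strings of length at most s. *)
Notation msg s := (s.-bseq bool).

(* A triple (X, k, c).  Positions are numbered from 0, so the part of X strictly
   before position k is [take k X]. *)
Notation input n := ((n.-tuple bool * 'I_n * bool)%type).

Definition inX (n : nat) (w : input n) : n.-tuple bool := w.1.1.
Definition ink (n : nat) (w : input n) : 'I_n := w.1.2.
Definition inc (n : nat) (w : input n) : bool := w.2.
Definition inprefix (n : nat) (w : input n) : seq bool := take (ink w) (inX w).

Definition mountain_fun (n : nat) (w : input n) : bool :=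
  tnth (inX w) (ink w) (+) inc w.

Definition ascension_fun (m n : nat) (v : {ffun 'I_m -> input n}) : bool :=
  [exists i, mountain_fun (v i)].

Definition mu0 (R : realType) (n : nat) : input n -> R :=
  cond (@unif R _) (fun w => tnth (inX w) (ink w) == inc w).

(* Coins are drawn from arbitrary distributions on finite sets: inputs and
   messages being finite, more general coin spaces would not produce other
   joint laws of inputs and messages.  The public and the private coins are
   independent of each other and of the input.
   Alice's output may depend on her own message only through X and the public
   coins, which determine it. *)
Record mountain_protocol (R : realType) (s n : nat) := MountainProtocol {
  mt_pub : finType;
  mt_priv : finType;
  mt_dpub : mt_pub -> R;
  mt_dpriv : mt_priv -> R;
  mt_dpubP : is_dist mt_dpub;
  mt_dprivP : is_dist mt_dpriv;
  mt_A : n.-tuple bool -> mt_pub -> msg s;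
  mt_B : 'I_n -> bool -> seq bool -> msg s -> mt_pub -> mt_priv -> msg s;
  mt_out : n.-tuple bool -> msg s -> mt_pub -> bool
}.

Section Mountain.
Variables (R : realType) (s n : nat) (P : mountain_protocol R s n).

Definition mt_MB (w : input n) (r : mt_pub P) (rB : mt_priv P) : msg s :=
  mt_B (ink w) (inc w) (inprefix w) (mt_A (inX w) r) r rB.

Definition mt_result (w : input n) (r : mt_pub P) (rB : mt_priv P) : bool :=
  mt_out (inX w) (mt_MB w r rB) r.

Definition mt_error_le (delta : R) : Prop :=
  forall w : input n,
    pr (fun z : mt_pub P * mt_priv P => mt_dpub z.1 * mt_dpriv z.2)
       (fun z => mt_result w z.1 z.2 != mountain_fun w) <= delta.

Definition mt_IC (nu : input n -> R) : R :=
  cond_mutual_info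
    (fun z : input n * (mt_pub P * mt_priv P) =>
       nu z.1 * (mt_dpub z.2.1 * mt_dpriv z.2.2))
    (fun z => (ink z.1, inc z.1))
    (fun z => mt_MB z.1 z.2.1 z.2.2)
    (fun z => (inX z.1, z.2.1)).

End Mountain.

(* Each message is computed by its sender from its own input, the message it has
   just received, and the public coins.  Players keep no memory between the two
   rounds (as in the streaming model, where the only state is the message being
   passed on): in round 2, A_i no longer has access to the message it received
   from B_(i-1) in round 1. *)
Record ascension_protocol (R : realType) (s m n : nat) := AscensionProtocol {
  as_pub : finType;
  as_dpub : as_pub -> R;
  as_dpubP : is_dist as_dpub;
  as_A : 'I_m -> n.-tuple bool -> msg s -> as_pub -> msg s;
  as_B : 'I_m -> 'I_n -> bool -> seq bool -> msg s -> as_pub -> msg s;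
  as_A' : 'I_m -> n.-tuple bool -> msg s -> as_pub -> msg s;
  as_out : n.-tuple bool -> msg s -> as_pub -> bool
}.

Section Ascension.
Variables (R : realType) (s m n : nat) (P : ascension_protocol R s m n).
Implicit Types (v : {ffun 'I_m -> input n}) (r : as_pub P).

(* M_(B_i) as a function of M_(B_(i-1)) *)
Definition as_step v r (M : msg s) (i : 'I_m) : msg s :=
  as_B i (ink (v i)) (inc (v i)) (inprefix (v i)) (as_A i (inX (v i)) M r) r.

(* The message of the last B-player; the first A-player, who receives nothing in
   round 1, is given the empty message. *)
Definition as_MB v r : msg s := foldl (as_step v r) [bseq] (enum 'I_m).

(* Round 2, in decreasing order of the players; the first A-player outputs.
   The value for m = 0 is irrelevant. *)
Definition as_result v r : bool :=
  if enum 'I_m is i1 :: s2 then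
    as_out (inX (v i1)) (foldr (fun i M => as_A' i (inX (v i)) M r) (as_MB v r) s2) r
  else false.

Definition as_error_le (delta : R) : Prop :=
  forall v, pr (@as_dpub _ _ _ _ P) (fun r => as_result v r != ascension_fun v) <= delta.

Definition as_IC (nu : {ffun 'I_m -> input n} -> R) : R :=
  cond_mutual_info
    (fun z : {ffun 'I_m -> input n} * as_pub P => nu z.1 * as_dpub z.2)
    (fun z => [ffun i => (ink (z.1 i), inc (z.1 i))])
    (fun z => as_MB z.1 z.2)
    (fun z => ([ffun i => inX (z.1 i)], z.2)).

End Ascension.

(* Infima in the extended reals: +oo when no protocol has error at most delta. *)

Definition IC_mix_mountain (R : realType) (s n : nat) (nu : input n -> R)
    (delta : R) : \bar R :=
  ereal_inf [set x | exists P : mountain_protocol R s n,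
                       mt_error_le P delta /\ x = (mt_IC P nu)%:E].

Definition IC_pub_ascension (R : realType) (s m n : nat)
    (nu : {ffun 'I_m -> input n} -> R) (delta : R) : \bar R :=
  ereal_inf [set x | exists P : ascension_protocol R s m n,
                       as_error_le P delta /\ x = (as_IC P nu)%:E].

Lemma cond_is_dist (R : realType) (W : finType) (d : W -> R) (E : pred W) :
  is_dist d -> pr d E != 0 -> is_dist (cond d E).
Proof.
move=> [d0 d1] E0; split=> [w|].
  by rewrite /cond; case: ifP => // _; apply: divr_ge0 => //; apply: sumr_ge0.
by rewrite /cond -big_mkcond /= -mulr_suml divff.
Qed.

Lemma mu0_is_dist (R : realType) (n : nat) : (0 < n)%N -> is_dist (@mu0 R n).
Proof.
case: n => // n _; apply: cond_is_dist.
  split=> [w|]; first by rewrite /unif invr_ge0.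
  rewrite sumr_const -[LHS]mulr_natr mulVf // pnatr_eq0 -lt0n.
  by apply/card_gt0P; exists ([tuple of nseq n.+1 false], ord0, false).
have wE : tnth [tuple of nseq n.+1 false] ord0 == false by rewrite tnth_nseq.
rewrite /pr (bigD1 ([tuple of nseq n.+1 false], ord0, false)) //=.
apply: lt0r_neq0; apply: ltr_wpDr.
  by apply: sumr_ge0 => w _; rewrite /unif invr_ge0.
rewrite /unif invr_gt0 ltr0n.
by apply/card_gt0P; exists ([tuple of nseq n.+1 false], ord0, false).
Qed.

Lemma iid_is_dist (R : realType) (W : finType) (d : W -> R) (m : nat) :
  is_dist d -> is_dist (@iid R W d m).
Proof.
move=> [d0 d1]; split=> [f|]; first by apply: prodr_ge0.
rewrite /iid -(bigA_distr_bigA (fun=> d)) /=.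
by rewrite big1.
Qed.

(* Main.v *)
(* Given an ASCENSION protocol, MOUNTAIN is solved for each j by playing the
   j-th pair of players and sampling the other triples from mu_0, where the
   disjunction is not affected: the strings X_i for i <> j and the indices k_i
   for i < j are public coins, which lets Alice compute the messages before and
   after Bob's, and the k_i for i > j are private coins of Bob.  Under mu_0 the
   index k is uniform and independent of X, with c = X[k], so the coins can be
   chosen independent of each other.  The information cost of this protocol is
   I(k_j, c_j : M_(B_m) | X, R, k_1, c_1, ..., k_(j-1), c_(j-1)), and by the
   chain rule these costs add up to that of the ASCENSION protocol. *)
Require Import Defs.
From mathcomp Require Import all_boot all_order all_algebra.
From mathcomp Require Import all_classical all_reals all_analysis.
Local Open Scope ring_scope.

Set Implicit Arguments.
Unset Strict Implicit.
Unset Printing Implicit Defensive.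
Import Order.TTheory GRing.Theory Num.Theory.

(** * Conditional entropy: form as an expectation, chain rule, change of probability space *)

Section Entropy.
Variable R : realType.

(** Summing over sample points instead of values lets later arguments work pointwise and discard
    points of mass 0. *)
Lemma cond_entropyE (W TA TC : finType) (d : W -> R) (A : W -> TA) (C : W -> TC) :
  cond_entropy d A C =
  - \sum_w d w * log2 (pr d (fun u => (A u == A w) && (C u == C w)) /
                       pr d (fun u => C u == C w)).
Proof.
rewrite /cond_entropy; congr (- _).
rewrite [RHS](partition_big C xpredT) //=; apply: eq_bigr => c _.
rewrite [RHS](partition_big A xpredT) //=; apply: eq_bigr => a _.
rewrite {1}/pr mulr_suml; apply: eq_big => [w|w /andP[/eqP <- /eqP <-]] //.
by rewrite andbC.
Qed.

Lemma log2M (x y : R) : 0 < x -> 0 < y -> log2 (x * y) = log2 x + log2 y.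
Proof. by move=> x0 y0; rewrite /log2 lnM ?posrE // mulrDl. Qed.

Lemma log2_telescope (p : nat -> R) (m : nat) : (forall j, 0 < p j) ->
  log2 (p m / p 0%N) = \sum_(j < m) log2 (p j.+1 / p j).
Proof.
move=> p0; elim: m => [|m IHm].
  by rewrite big_ord0 divff ?gt_eqF // /log2 ln1 mul0r.
rewrite big_ord_recr /= -IHm -log2M ?divr_gt0 //; congr log2.
by rewrite [RHS]mulrC mulrA divfK ?gt_eqF.
Qed.

Lemma pr_gt0 (W : finType) (d : W -> R) (E : pred W) (w : W) :
  (forall u, 0 <= d u) -> d w != 0 -> E w -> 0 < pr d E.
Proof.
move=> d0 dw Ew; rewrite /pr (bigD1 w) //= ltr_pwDl ?sumr_ge0 //.
by rewrite lt_def dw d0.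
Qed.

(** Masking with [None] gives prefixes of all lengths the same finite type. *)
Definition truncate (T : finType) (m : nat) (j : nat) (f : {ffun 'I_m -> T}) :
    {ffun 'I_m -> option T} :=
  [ffun i : 'I_m => if (i < j)%N then Some (f i) else None].

Lemma eq_truncate (T : finType) (m j : nat) (f g : {ffun 'I_m -> T}) :
  (truncate j f == truncate j g) = [forall i : 'I_m, (i < j)%N ==> (f i == g i)].
Proof.
apply/eqP/forallP => [/ffunP e i|e].
  by apply/implyP => ij; move: (e i); rewrite !ffunE ij => -[->].
by apply/ffunP => i; rewrite !ffunE; case: ifP (e i) => //= _ /eqP ->.
Qed.

Lemma eq_truncateS (T : finType) (m : nat) (j : 'I_m) (f g : {ffun 'I_m -> T}) :
  (truncate j.+1 f == truncate j.+1 g) =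
  (f j == g j) && (truncate j f == truncate j g).
Proof.
rewrite !eq_truncate; apply/forallP/andP => [e|[/eqP e1 /forallP e2] i].
  split; first by move: (e j); rewrite ltnSn.
  by apply/forallP => i; apply/implyP => ij; move: (e i); rewrite ltnW.
apply/implyP; rewrite ltnS leq_eqVlt => /orP[/eqP /val_inj ->|ij].
  by rewrite e1.
by move: (e2 i); rewrite ij.
Qed.

Lemma cond_entropy_chain (W T TC : finType) (m : nat) (d : W -> R)
    (K : W -> {ffun 'I_m -> T}) (C : W -> TC) : (forall w, 0 <= d w) ->
  cond_entropy d K C =
  \sum_(j < m) cond_entropy d (fun w => K w j) (fun w => (C w, truncate j (K w))).
Proof.
move=> d0; rewrite cond_entropyE.
under [RHS]eq_bigr do rewrite cond_entropyE.
rewrite sumrN exchange_big /=; congr (- _); apply: eq_bigr => w _.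
have [->|dw] := eqVneq (d w) 0; first by rewrite mul0r big1 // => j _; rewrite mul0r.
(* [p 0] is the probability of the value of [C], [p m] the joint one, and consecutive ratios are the
   conditional probabilities of single coordinates, so the logarithms telescope. *)
pose p j := pr d (fun u => (truncate j (K u) == truncate j (K w)) && (C u == C w)).
have p0 j : 0 < p j by apply: (@pr_gt0 _ _ _ w) => //; rewrite !eqxx.
rewrite -mulr_sumr; congr (_ * _).
transitivity (log2 (p m / p 0%N)).
  congr (log2 (_ / _)); apply: eq_bigl => u; last first.
    by rewrite [X in X && _](_ : _ = true) // eq_truncate; apply/forallP.
  rewrite eq_truncate; congr andb; apply/eqP/forallP => [-> i|e].
    by rewrite eqxx implybT.
  by apply/ffunP => i; move: (e i); rewrite ltn_ord => /eqP.
rewrite log2_telescope //; apply: eq_bigr => j _.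
congr (log2 (_ / _)); apply: eq_bigl => u; rewrite xpair_eqE.
  by rewrite eq_truncateS -!andbA [(C u == _) && _]andbC.
by rewrite andbC.
Qed.

(** Surjectivity of [psi] need not be assumed: both total masses are 1, so the image of the support
    of [d] carries all of [d']. *)
Lemma expectation_transport (W W' : finType) (d : W -> R) (d' : W' -> R)
    (psi : W -> W') (F : W' -> R) :
  is_dist d -> is_dist d' ->
  {in [pred w | d w != 0] &, injective psi} ->
  (forall w, d w != 0 -> d' (psi w) = d w) ->
  \sum_w' d' w' * F w' = \sum_w d w * F (psi w).
Proof.
move=> [d0 d1] [d'0 d'1] inj_psi d'psi.
pose S := finset (fun w => d w != 0).
have inS w : (w \in S) = (d w != 0) by rewrite inE.
have sumS (G : W' -> R) :
    \sum_(w' in imset psi (mem S)) d' w' * G w' = \sum_w d w * G (psi w).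
  rewrite big_imset /=; last by move=> u v; rewrite !inS; apply: inj_psi.
  rewrite [RHS](bigID (mem S)) /= [X in _ + X]big1 ?addr0 => [|w].
    by apply: eq_bigr => w; rewrite inS => /d'psi ->.
  by rewrite inS negbK => /eqP ->; rewrite mul0r.
(* [sumS] with the constant 1 shows that the image already has mass 1; nonnegativity leaves nothing
   elsewhere. *)
have d'S : forall w', w' \notin imset psi (mem S) -> d' w' = 0.
  have total : \sum_(w' in imset psi (mem S)) d' w' = \sum_w' d' w'.
    rewrite d'1 -d1 -(eq_bigr _ (fun w _ => mulr1 (d w))) -(sumS (fun=> 1)).
    by under [RHS]eq_bigr do rewrite mulr1.
  move: total; rewrite [RHS](bigID (mem (imset psi (mem S)))) /= -[LHS]addr0.
  by move=> /addrI /esym e w' Sw'; apply: (psumr_eq0P _ e).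
rewrite (bigID (mem (imset psi (mem S)))) /= sumS [X in _ + X]big1 ?addr0 //.
by move=> w' /d'S ->; rewrite mul0r.
Qed.

(** Entropy sees random variables only through the partitions they induce on the support, so only
    equalities of values are compared and the value types may differ. *)
Lemma cond_entropy_transport (W W' TA TC TA' TC' : finType)
    (d : W -> R) (d' : W' -> R) (psi : W -> W')
    (A : W -> TA) (C : W -> TC) (A' : W' -> TA') (C' : W' -> TC') :
  is_dist d -> is_dist d' ->
  {in [pred w | d w != 0] &, injective psi} ->
  (forall w, d w != 0 -> d' (psi w) = d w) ->
  (forall u v, d u != 0 -> d v != 0 -> (A' (psi u) == A' (psi v)) = (A u == A v)) ->
  (forall u v, d u != 0 -> d v != 0 -> (C' (psi u) == C' (psi v)) = (C u == C v)) ->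
  cond_entropy d' A' C' = cond_entropy d A C.
Proof.
move=> dd dd' inj_psi d'psi eqA eqC; rewrite !cond_entropyE; congr (- _).
have tr := expectation_transport _ dd dd' inj_psi d'psi.
have prE (E' : pred W') (E : pred W) :
    (forall u, d u != 0 -> E' (psi u) = E u) -> pr d' E' = pr d E.
  move=> EE; rewrite /pr (big_mkcond E') (big_mkcond E) /=.
  transitivity (\sum_w' d' w' * (E' w')%:R).
    by apply: eq_bigr => w' _; case: (E' w'); rewrite ?mulr1 ?mulr0.
  rewrite tr; apply: eq_bigr => w _.
  have [->|dw] := eqVneq (d w) 0; first by rewrite mul0r if_same.
  by rewrite EE //; case: (E w); rewrite ?mulr1 ?mulr0.
rewrite tr; apply: eq_bigr => w _.
have [->|dw] := eqVneq (d w) 0; first by rewrite !mul0r.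
congr (_ * log2 (_ / _)); apply: prE => u du; last exact: eqC.
by rewrite eqA ?eqC.
Qed.

End Entropy.

(** * Coin distributions and the explicit mass function of [mu0] *)

Section Distributions.
Variable R : realType.

Lemma is_dist_pair (U V : finType) (d : U -> R) (e : V -> R) :
  is_dist d -> is_dist e -> is_dist (fun z : U * V => d z.1 * e z.2).
Proof.
move=> [d0 d1] [e0 e1]; split=> [w|]; first exact: mulr_ge0.
by rewrite -(pair_bigA _ (fun u v => d u * e v)) /=; under eq_bigr do
  rewrite -mulr_sumr e1 mulr1.
Qed.

Definition unif_on (T : finType) (t0 : T) (m : nat) (D : pred 'I_m)
    (f : {ffun 'I_m -> T}) : R :=
  \prod_i (if D i then #|T|%:R^-1 else (f i == t0)%:R).

Lemma unif_on_is_dist (T : finType) (t0 : T) (m : nat) (D : pred 'I_m) :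
  is_dist (unif_on t0 D).
Proof.
split=> [f|]; first by apply: prodr_ge0 => i _; case: ifP; rewrite ?invr_ge0.
rewrite /unif_on.
rewrite -(bigA_distr_bigA (fun i t => if D i then #|T|%:R^-1 else (t == t0)%:R)).
rewrite big1 //= => i _; case: (D i).
  rewrite sumr_const -[LHS]mulr_natr mulVf // pnatr_eq0 -lt0n.
  by apply/card_gt0P; exists t0.
by rewrite (bigD1 t0) //= eqxx big1 ?addr0 // => t /negbTE ->.
Qed.

Definition restrict (T : finType) (t0 : T) (m : nat) (D : pred 'I_m) (g : 'I_m -> T) :
    {ffun 'I_m -> T} :=
  [ffun i => if D i then g i else t0].

Lemma unif_on_restrict (T : finType) (t0 : T) (m : nat) (D : pred 'I_m) (g : 'I_m -> T) :
  unif_on t0 D (restrict t0 D g) = \prod_i (if D i then #|T|%:R^-1 else 1).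
Proof. by apply: eq_bigr => i _; rewrite ffunE; case: (D i); rewrite ?eqxx. Qed.

Lemma eq_restrict (T : finType) (t0 : T) (m : nat) (D : pred 'I_m) (f g : 'I_m -> T) :
  (restrict t0 D f == restrict t0 D g) = [forall i, D i ==> (f i == g i)].
Proof.
apply/eqP/forallP => [/ffunP e i|e].
  by apply/implyP => Di; move: (e i); rewrite !ffunE Di => ->.
by apply/ffunP => i; rewrite !ffunE; case: ifP (e i) => //= _ /eqP ->.
Qed.

(** All points of the support have equal mass [q], and each pair (X, k) admits exactly one bit, so
    normalisation determines [q]. The product form makes X and k independent and uniform. *)
Lemma mu0E (n : nat) (w : input n) : (0 < n)%N ->
  @mu0 R n w = if tnth (inX w) (ink w) == inc w
               then #|{: n.-tuple bool}|%:R^-1 * #|'I_n|%:R^-1 else 0.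
Proof.
move=> n0; have [_] := @mu0_is_dist R n n0.
pose q : R := @unif R (input n) w / pr (@unif R _) (fun u : input n => tnth (inX u) (ink u) == inc u).
have mu0q u : @mu0 R n u = if tnth (inX u) (ink u) == inc u then q else 0 by [].
rewrite mu0q; case: ifP => // _.
under eq_bigr => u _ do rewrite mu0q.
rewrite -(pair_bigA _ (fun (z : n.-tuple bool * 'I_n) (b : bool) =>
  if tnth z.1 z.2 == b then q else 0)) /=.
rewrite (eq_bigr (fun=> q)) => [|z _]; last first.
  by rewrite -big_mkcond /= (big_pred1 (tnth z.1 z.2)) // => b; rewrite eq_sym.
rewrite sumr_const card_prod -[LHS]mulr_natl natrM => e.
have c0 : #|{: n.-tuple bool}|%:R * #|'I_n|%:R != 0 :> R.
  by apply/eqP => c0; move/eqP: e; rewrite c0 mul0r eq_sym oner_eq0.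
by apply: (mulfI c0); rewrite e -invfM divff.
Qed.

End Distributions.

Arguments unif_on {R T} t0 {m} D f.
Arguments unif_on_is_dist {R T} t0 {m} D.

(** * The MOUNTAIN protocol at position [j]: correctness and information cost *)

Section Embedding.
Variables (R : realType) (s m n : nat) (P : ascension_protocol R s m n) (j : 'I_m).

(* The zeros of [mountain_fun] are the triples in the support of [mu0]. *)
Definition zero_input (X : n.-tuple bool) (k : 'I_n) : input n := (X, k, tnth X k).

Definition zero_inputs (Xs : 'I_m -> n.-tuple bool) (ks : 'I_m -> 'I_n) :
    {ffun 'I_m -> input n} := [ffun i => zero_input (Xs i) (ks i)].

Definition embed (w : input n) (Xs : {ffun 'I_m -> n.-tuple bool})
    (kpub kpriv : {ffun 'I_m -> 'I_n}) : {ffun 'I_m -> input n} :=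
  [ffun i => if i == j then w
             else zero_input (Xs i) (if (i < j)%N then kpub i else kpriv i)].

(** The sampled triples satisfy X[k] = c and contribute false to the disjunction. *)
Lemma embed_function w Xs kpub kpriv :
  ascension_fun (embed w Xs kpub kpriv) = mountain_fun w.
Proof.
apply/existsP/idP => [[i]|fw]; last by exists j; rewrite ffunE eqxx.
by rewrite ffunE; case: eqP => // _; rewrite /mountain_fun addbb.
Qed.

Definition public_coins : finType :=
  (as_pub P * ({ffun 'I_m -> n.-tuple bool} * {ffun 'I_m -> 'I_n}))%type.

Variables (X0 : n.-tuple bool) (k0 : 'I_n).

(* The coordinates of the coins that are not used are fixed to [X0] and [k0], so
   that the coins and the MOUNTAIN input are in bijection with the ASCENSION
   input and its coins on the support of the distributions. *)
Definition embedded_mountain : mountain_protocol R s n :=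
  @MountainProtocol R s n public_coins {ffun 'I_m -> 'I_n}
    (fun r => as_dpub r.1 * (unif_on X0 (predC1 j) r.2.1 *
                             unif_on k0 (fun i => (i < j)%N) r.2.2))
    (unif_on k0 (fun i => (j < i)%N))
    (is_dist_pair (as_dpubP P) (is_dist_pair (unif_on_is_dist X0 _)
                                             (unif_on_is_dist k0 _)))
    (unif_on_is_dist k0 _)
    (fun X r => as_A j X (foldl (as_step (zero_inputs r.2.1 r.2.2) r.1) [bseq]
                                (take j (enum 'I_m))) r.1)
    (fun k c pre M r kpriv =>
       foldl (as_step (zero_inputs r.2.1 kpriv) r.1) (as_B j k c pre M r.1)
             (drop j.+1 (enum 'I_m)))
    (fun X M r =>
       let Xs i := if i == j then X else r.2.1 i in
       if enum 'I_m is i1 :: s2 then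
         as_out (Xs i1) (foldr (fun i M => as_A' i (Xs i) M r.1) M s2) r.1
       else false).

Lemma eq_as_step (u v : {ffun 'I_m -> input n}) r (M : msg s) (l : seq 'I_m) :
  {in l, u =1 v} -> foldl (@as_step _ _ _ _ P u r) M l = foldl (as_step v r) M l.
Proof.
elim: l M => //= i l IHl M uv; rewrite IHl => [|k kl]; last first.
  by apply: uv; rewrite inE kl orbT.
by rewrite /as_step uv // mem_head.
Qed.

Lemma mem_take_enum (i : 'I_m) : i \in take j (enum 'I_m) -> (i < j)%N.
Proof.
move=> /(map_f val); rewrite map_take val_enum_ord take_iota mem_iota /=.
by rewrite add0n leq_min => /andP[].
Qed.

Lemma mem_drop_enum (i : 'I_m) : i \in drop j.+1 (enum 'I_m) -> (j < i)%N.
Proof.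
by move=> /(map_f val); rewrite map_drop val_enum_ord drop_iota mem_iota => /andP[].
Qed.

Lemma enum_split : enum 'I_m = take j (enum 'I_m) ++ j :: drop j.+1 (enum 'I_m).
Proof.
rewrite -[LHS](cat_take_drop j) (drop_nth j) ?size_enum_ord //.
by rewrite nth_ord_enum.
Qed.

(** Cut the fold over the players at [j]: Alice simulates the pairs before it and Bob those after
    it, each with inputs that agree with [embed] there. *)
Lemma embedded_MB w (r : public_coins) kpriv :
  @mt_MB _ _ _ embedded_mountain w r kpriv = as_MB (embed w r.2.1 r.2.2 kpriv) r.1.
Proof.
have stepj M : as_step (embed w r.2.1 r.2.2 kpriv) r.1 M j =
    as_B j (ink w) (inc w) (inprefix w) (as_A j (inX w) M r.1) r.1.
  by rewrite /as_step ffunE eqxx.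
rewrite /as_MB [in RHS]enum_split foldl_cat /= stepj /mt_MB /=.
rewrite (@eq_as_step (embed w r.2.1 r.2.2 kpriv) (zero_inputs r.2.1 r.2.2) _ _
  (take j (enum 'I_m))); last first.
  by move=> i /mem_take_enum ij; rewrite !ffunE ij -val_eqE ltn_eqF.
apply: eq_as_step => i /mem_drop_enum ij.
by rewrite !ffunE -val_eqE gtn_eqF // ltnNge ltnW.
Qed.

Lemma embedded_result w (r : public_coins) kpriv :
  @mt_result _ _ _ embedded_mountain w r kpriv =
  as_result (embed w r.2.1 r.2.2 kpriv) r.1.
Proof.
rewrite /mt_result embedded_MB /as_result /=.
have XE i : (if i == j then inX w else r.2.1 i) = inX (embed w r.2.1 r.2.2 kpriv i).
  by rewrite ffunE; case: eqP.
case: (enum 'I_m) => // i1 s2; rewrite XE; congr as_out.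
by elim: s2 => //= i s2 ->; rewrite XE.
Qed.

(** For fixed sampled triples the error is that of [P] on one input, to which the worst-case bound
    applies; then average over the samples. *)
Lemma embedded_error delta : as_error_le P delta -> mt_error_le embedded_mountain delta.
Proof.
move=> err w; rewrite /pr big_mkcond /=.
pose q (x : {ffun 'I_m -> n.-tuple bool} * {ffun 'I_m -> 'I_n}) (kpriv : {ffun 'I_m -> 'I_n}) : R :=
  unif_on X0 (predC1 j) x.1 * unif_on k0 (fun i => (i < j)%N) x.2 *
  unif_on k0 (fun i => (j < i)%N) kpriv.
have [q0 q1] : is_dist (fun z => q z.1 z.2).
  exact: is_dist_pair (is_dist_pair (unif_on_is_dist X0 _) (unif_on_is_dist k0 _))
                      (unif_on_is_dist k0 _).
(* Writing [delta] as an average under [q] allows a termwise comparison, once the sums are reordered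
   to put the coins of [P] innermost. *)
rewrite -[delta]mul1r -q1 mulr_suml.
rewrite -(pair_bigA _ (fun (r : public_coins) kpriv =>
  if @mt_result _ _ _ embedded_mountain w r kpriv != mountain_fun w
  then @mt_dpub _ _ _ embedded_mountain r * @mt_dpriv _ _ _ embedded_mountain kpriv
  else 0)) /=.
rewrite -(pair_bigA _ (fun r x => \sum_kpriv
  if @mt_result _ _ _ embedded_mountain w (r, x) kpriv != mountain_fun w
  then @mt_dpub _ _ _ embedded_mountain (r, x) * @mt_dpriv _ _ _ embedded_mountain kpriv
  else 0)) /=.
rewrite exchange_big /=.
rewrite -(pair_bigA _ (fun x kpriv => q x kpriv * delta)) /=.
apply: ler_sum => x _; rewrite exchange_big; apply: ler_sum => kpriv _.
apply: le_trans (ler_wpM2l (q0 (x, kpriv)) (err (embed w x.1 x.2 kpriv))).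
rewrite /pr [in leRHS]big_mkcond mulr_sumr; apply: ler_sum => r _.
have := embedded_result w (r, x) kpriv; rewrite /mt_result /mt_MB /= => ->.
rewrite embed_function; case: ifP; rewrite ?mulr0 //.
by rewrite /q /= => _; rewrite [leRHS]mulrC -[leLHS]mulrA.
Qed.


Variable n_gt0 : (0 < n)%N.

Definition ascension_dist (z : {ffun 'I_m -> input n} * as_pub P) : R :=
  iid (@mu0 R n) z.1 * as_dpub z.2.

Definition mountain_dist (z : input n * (public_coins * {ffun 'I_m -> 'I_n})) : R :=
  mu0 R z.1 * (@mt_dpub _ _ _ embedded_mountain z.2.1 *
               @mt_dpriv _ _ _ embedded_mountain z.2.2).

(** Inverse to [embed] on the support: the bits at positions other than [j] are dropped, being
    determined there by the string and the index. *)
Definition split_inputs (z : {ffun 'I_m -> input n} * as_pub P) :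
    input n * (public_coins * {ffun 'I_m -> 'I_n}) :=
  (z.1 j, ((z.2, (restrict X0 (predC1 j) (fun i => inX (z.1 i)),
                  restrict k0 (fun i => (i < j)%N) (fun i => ink (z.1 i)))),
           restrict k0 (fun i => (j < i)%N) (fun i => ink (z.1 i)))).

Lemma ascension_distP : is_dist ascension_dist.
Proof. exact: is_dist_pair (iid_is_dist _ (mu0_is_dist R n_gt0)) (as_dpubP P). Qed.

Lemma mountain_distP : is_dist mountain_dist.
Proof.
exact: is_dist_pair (mu0_is_dist R n_gt0)
  (is_dist_pair (mt_dpubP embedded_mountain) (mt_dprivP embedded_mountain)).
Qed.

Lemma ascension_dist_zero z i : ascension_dist z != 0 ->
  z.1 i = zero_input (inX (z.1 i)) (ink (z.1 i)).
Proof.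
rewrite /ascension_dist mulf_eq0 negb_or => /andP[/prodf_neq0 /(_ i isT)].
rewrite mu0E //; case: ifP => [|_ /eqP //].
by case: (z.1 i) => -[X k] c /eqP; rewrite /inc /= => <-.
Qed.

Lemma split_inputsK z : ascension_dist z != 0 ->
  embed (split_inputs z).1 (split_inputs z).2.1.2.1 (split_inputs z).2.1.2.2
        (split_inputs z).2.2 = z.1.
Proof.
move=> dz; apply/ffunP => i; rewrite ffunE /=; case: eqP => [-> //|/eqP ij].
rewrite [in RHS](ascension_dist_zero i dz) !ffunE /= ij; congr zero_input.
by case: ltngtP => // /val_inj ji; rewrite ji eqxx in ij.
Qed.

Lemma split_inputs_inj :
  {in [pred z | ascension_dist z != 0] &, injective split_inputs}.
Proof.
move=> y z dy dz e; have := split_inputsK dy; rewrite e split_inputsK // => e1.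
by case: y z e e1 {dy dz} => [y1 y2] [z1 z2] [_ -> _ _ _] /= ->.
Qed.

(** Compare factors position by position: away from [j], the string coin and exactly one of the two
    index coins supply the two factors of [mu0]; at [j] all coins are constant. *)
Lemma mountain_dist_split z : ascension_dist z != 0 ->
  mountain_dist (split_inputs z) = ascension_dist z.
Proof.
move=> dz; rewrite /mountain_dist /ascension_dist /=.
rewrite !unif_on_restrict.
have -> : mu0 R (z.1 j) = \prod_i (if i == j then mu0 R (z.1 i) else 1).
  by rewrite -big_mkcond big_pred1_eq.
rewrite -mulrA mulrCA mulrC; congr (_ * _).
rewrite mulrA -!big_split; apply: eq_bigr => i _ /=.
have -> : @mu0 R n (z.1 i) = #|{: n.-tuple bool}|%:R^-1 * #|'I_n|%:R^-1.
  by rewrite mu0E // (ascension_dist_zero i dz) eqxx.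
rewrite -val_eqE /=; case: ltngtP => _ /=; rewrite ?mul1r ?mulr1 //.
Qed.

Definition queries (z : {ffun 'I_m -> input n} * as_pub P) : {ffun 'I_m -> 'I_n * bool} :=
  [ffun i => (ink (z.1 i), inc (z.1 i))].

Definition strings (z : {ffun 'I_m -> input n} * as_pub P) :=
  ([ffun i => inX (z.1 i)], z.2).

(** What MOUNTAIN conditions on is equivalent to the condition in the chain rule: public coins hold
    the indices before [j], and the strings then give the bits. *)
Lemma eq_split_public y z : ascension_dist y != 0 -> ascension_dist z != 0 ->
  ((inX (split_inputs y).1, (split_inputs y).2.1) ==
   (inX (split_inputs z).1, (split_inputs z).2.1)) =
  ((strings y, truncate j (queries y)) == (strings z, truncate j (queries z))).
Proof.
move=> dy dz; rewrite !xpair_eqE eq_truncate !eq_restrict.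
apply/and4P/andP => [[/eqP Xj r /forallP Xs /forallP ks]|[/andP[/eqP/ffunP X r] /forallP K]].
  have X i : inX (y.1 i) = inX (z.1 i).
    by have [->//|ij] := eqVneq i j; move: (Xs i); rewrite /= ij => /eqP.
  split.
    by rewrite r andbT; apply/eqP/ffunP => i; rewrite !ffunE.
  apply/forallP => i; apply/implyP => ij; rewrite !ffunE.
  move: (ks i); rewrite ij => /eqP k.
  by rewrite (ascension_dist_zero i dy) (ascension_dist_zero i dz) X k.
have {}X i : inX (y.1 i) = inX (z.1 i) by move: (X i); rewrite !ffunE.
split=> //; first by rewrite X.
  by apply/forallP => i; rewrite X eqxx implybT.
apply/forallP => i; apply/implyP => ij; move: (K i).
by rewrite ij !ffunE => /eqP[->].
Qed.

(** Both entropies are transported along [split_inputs]; the pairs are nested as the chain rule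
    produces them. *)
Lemma embedded_IC :
  mt_IC embedded_mountain (@mu0 R n) =
  cond_entropy ascension_dist (fun z => queries z j)
    (fun z => (strings z, truncate j (queries z))) -
  cond_entropy ascension_dist (fun z => queries z j)
    (fun z => ((as_MB z.1 z.2, strings z), truncate j (queries z))).
Proof.
have eqA y z : ascension_dist y != 0 -> ascension_dist z != 0 ->
    ((ink (split_inputs y).1, inc (split_inputs y).1) ==
     (ink (split_inputs z).1, inc (split_inputs z).1)) = (queries y j == queries z j).
  by rewrite !ffunE.
have MBE z : ascension_dist z != 0 ->
    @mt_MB _ _ _ embedded_mountain (split_inputs z).1 (split_inputs z).2.1
      (split_inputs z).2.2 = as_MB z.1 z.2.
  by move=> dz; rewrite embedded_MB split_inputsK.
congr (_ - _); apply: (cond_entropy_transport ascension_distP mountain_distP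
  split_inputs_inj mountain_dist_split) => // y z dy dz; first exact: eq_split_public.
have := eq_split_public dy dz; rewrite !MBE // !xpair_eqE => ->.
by rewrite andbA.
Qed.

End Embedding.

(** * Summing the costs over positions and passing to infima *)

Lemma as_IC_sum (R : realType) (s m n : nat) (P : ascension_protocol R s m n)
    (X0 : n.-tuple bool) (k0 : 'I_n) : (0 < n)%N ->
  as_IC P (iid (@mu0 R n) (m := m)) =
  \sum_(j < m) mt_IC (embedded_mountain P j X0 k0) (@mu0 R n).
Proof.
move=> n0; rewrite (eq_bigr _ (fun j _ => embedded_IC P j X0 k0 n0)) sumrB.
have [d0 _] := ascension_distP P n0.
(* The chain rule is used twice, without and with the last message in the condition. *)
by congr (_ - _); apply: cond_entropy_chain.
Qed.

Lemma sume_const_ord (R : realType) (m : nat) (x : \bar R) :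
  (\sum_(i < m) x = x *+ m)%E.
Proof.
elim: m => [|m IHm]; first by rewrite big_ord0.
by rewrite big_ord_recl IHm muleS.
Qed.

Theorem lemma3 (R : realType) (size : nat -> nat -> nat) (m n : nat)
    (hm : (0 < m)%N) (hn : (0 < n)%N) (delta : R) :
  (IC_pub_ascension (size m n) (iid (@mu0 R n) (m := m)) delta
   >= m%:R%:E * IC_mix_mountain (size m n) (@mu0 R n) delta)%E.
Proof.
apply: le_ereal_inf_tmp => _ [P [errP ->]].
pose X0 : n.-tuple bool := [tuple of nseq n false].
(* The multiple of the infimum becomes a sum of [m] copies, each compared with the cost of one
   embedded protocol. *)
rewrite (as_IC_sum P X0 (Ordinal hn) hn) -sumEFin mule_natl -sume_const_ord.
apply: lee_sum => j _; apply: ereal_inf_lbound.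
exists (embedded_mountain P j X0 (Ordinal hn)); split=> //.
exact: embedded_error.
Qed.
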